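(* Let $K$ be a field of characteristic zero, let $\alpha,\beta,\gamma\in K$ be nonzero, and let $\mathbb{M}=\mathbb{M}(\alpha,\beta,\gamma)$ be the seven dimensional simple Malcev algebra over $K$ with parameters $\alpha,\beta,\gamma$. Let $c_{\mathbb{M}}=c_{\mathbb{M}}(\alpha,\beta,\gamma)$ be the standard Casimir element of the Poisson enveloping algebra $P(\mathbb{M})$, and let $0\neq\lambda\in K$. Then the generic Poisson algebra $S=P(\mathbb{M})/(c_{\mathbb{M}}-\lambda)$ is central and simple.
   Context: The algebra $\mathbb{M}(\alpha,\beta,\gamma)$ has basis $f_1,\ldots,f_7$ over $K$ and a skew-symmetric bilinear product $[\,,]$ obtained by formally putting $f_1=\sqrt{\alpha}\,e_1$, $f_2=\sqrt{\beta}\,e_2$, $f_3=\sqrt{\gamma}\,e_3$, $f_4=\sqrt{\alpha\beta}\,e_4$, $f_5=\sqrt{\beta\gamma}\,e_5$, $f_6=\sqrt{\alpha\beta\gamma}\,e_6$, $f_7=\sqrt{\alpha\gamma}\,e_7$, where $[e_i,e_{i+1}]=e_{i+3}$, $[e_{i+1},e_{i+3}]=e_i$, $[e_{i+3},e_i]=e_{i+1}$ (indices modulo 7, in $\{1,\ldots,7\}$). Explicitly: $[f_1,f_2]=f_4$, $[f_2,f_4]=\beta f_1$, $[f_4,f_1]=\alpha f_2$; $[f_2,f_3]=f_5$, $[f_3,f_5]=\gamma f_2$, $[f_5,f_2]=\beta f_3$; $[f_3,f_4]=f_6$, $[f_4,f_6]=\alpha\beta f_3$, $[f_6,f_3]=\gamma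 f_4$; $[f_4,f_5]=\beta f_7$, $[f_5,f_7]=\gamma f_4$, $[f_7,f_4]=\alpha f_5$; $[f_5,f_6]=\beta\gamma f_1$, $[f_6,f_1]=\alpha f_5$, $[f_1,f_5]=f_6$; $[f_6,f_7]=\alpha\gamma f_2$, $[f_7,f_2]=f_6$, $[f_2,f_6]=\beta f_7$; $[f_7,f_1]=\alpha f_3$, $[f_1,f_3]=f_7$, $[f_3,f_7]=\gamma f_1$. A generic Poisson algebra is a commutative associative algebra with a skew-symmetric bilinear bracket $\{\,,\}$ satisfying the Leibniz identity $\{x,yz\}=\{x,y\}z+y\{x,z\}$ (no Jacobi identity is required). For an algebra $L$ with skew-symmetric bilinear product $[\,,]$ and basis $e_1,e_2,\ldots$, the Poisson enveloping algebra $P(L)$ is the polynomial algebra $K[e_1,e_2,\ldots]$ with the unique skew-symmetric bilinear bracket $\{\,,\}$ satisfying the Leibniz identity and $\{e_i,e_j\}=[e_i,e_j]$; it is a generic Poisson algebra independent of the basis. The standard Casimir element of $P(\mathbb{M}(\alpha,\beta,\gamma))=K[f_1,\ldots,f_7]$ is $c_{\mathbb{M}}(\alpha,\beta,\gamma)=\beta\gamma f_1^2+\alpha\gamma f_2^2+\alpha\beta f_3^2+\gamma f_4^2+\alpha f_5^2+f_6^2+\beta f_7^2$; it satisfies $\{c_{\mathbb{M}},g\}=0$ for all $g\in P(\mathbb{M})$. Hence the ideal $(c_{\mathbb{M}}-\lambda)$ of the polynomial algebra generated by $c_{\mathbb{M}}-\lambda$ is stable under brackets, and $S$ is the quotient with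 the induced product and bracket. The center of a generic Poisson algebra $A$ is $Z(A)=\{a\in A:\{a,b\}=0\text{ for all }b\in A\}$, and $A$ (unital, over $K$) is central if $Z(A)=K$. $A$ is simple if the only ideals $I$ of the commutative associative algebra $A$ with $\{A,I\}\subseteq I$ are $0$ and $A$. *)

(* Defs.v *)
From HB Require Import structures.
From mathcomp Require Import all_boot all_order all_algebra.
From mathcomp Require Import generic_quotient ring_quotient boolp mpoly.
From mathcomp Require Import ring.

Set Implicit Arguments.
Unset Strict Implicit.
Unset Printing Implicit Defensive.

Import GRing.Theory.
Local Open Scope ring_scope.

Reserved Notation "[{ x , y }]" (at level 0, x, y at level 99,
  format "[{ x ,  y }]").

(* No Jacobi identity is required.  Linearity in the first argument follows
   from skew-symmetry (lemma [bracketP] below). *)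
HB.mixin Record isGenericPoisson (K : fieldType) A of GRing.ComAlgebra K A := {
  bracket : A -> A -> A;
  bracket_linear : forall x : A, linear (bracket x);
  bracketC : forall x y : A, bracket x y = - bracket y x;
  bracketMr : forall x y z : A,
    bracket x (y * z) = bracket x y * z + y * bracket x z
}.

#[short(type="genPoissonType")]
HB.structure Definition GenericPoisson (K : fieldType) :=
  {A of isGenericPoisson K A & GRing.ComAlgebra K A}.

Arguments bracket {K s} x y.
Notation "[{ x , y }]" := (bracket x y) : ring_scope.

Section GenericPoissonTheory.
Variables (K : fieldType) (A : genPoissonType K).
Implicit Types (x y z : A) (k : K).

HB.instance Definition _ x :=
  GRing.isLinear.Build K A A *:%R (bracket x) (bracket_linear x).

Lemma bracketP k x y z : [{ k *: x + y, z }] = k *: [{ x, z }] + [{ y, z }].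
Proof. by rewrite bracketC linearP /= opprD -scalerN -!bracketC. Qed.

Lemma bracketDl x y z : [{ x + y, z }] = [{ x, z }] + [{ y, z }].
Proof. by rewrite -[x]scale1r bracketP !scale1r. Qed.

Lemma bracketBl x y z : [{ x - y, z }] = [{ x, z }] - [{ y, z }].
Proof.
by rewrite addrC -scaleN1r bracketP scaleN1r addrC.
Qed.

Lemma bracketMl x y z : [{ x * y, z }] = [{ x, z }] * y + x * [{ y, z }].
Proof.
by rewrite bracketC bracketMr opprD -mulNr -mulrN -!bracketC.
Qed.

Lemma bracketx1 x : [{ x, 1 }] = 0.
Proof.
apply: (@addrI _ [{ x, 1 }]).
by rewrite addr0 -[in RHS](mulr1 1) bracketMr mulr1 mul1r.
Qed.

Lemma bracketxA x k : [{ x, k%:A }] = 0.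
Proof. by rewrite linearZ /= bracketx1 scaler0. Qed.

Definition in_center x : Prop := forall y, [{ x, y }] = 0.

Definition bracket_ideal (I : A -> Prop) : Prop :=
  [/\ I 0,
      forall x y, I x -> I y -> I (x + y),
      forall a x, I x -> I (a * x) &
      forall a x, I x -> I [{ a, x }]].

End GenericPoissonTheory.

Definition poisson_central (K : fieldType) (A : genPoissonType K) : Prop :=
  forall x : A, in_center x <-> exists k : K, x = k%:A.

(* [A] is nonzero because a [comAlgType] satisfies [1 != 0]. *)
Definition poisson_simple (K : fieldType) (A : genPoissonType K) : Prop :=
  forall I : A -> Prop, bracket_ideal I ->
    (forall x, I x <-> x = 0) \/ (forall x, I x).

HB.mixin Record isBracketStable (K : fieldType) (A : genPoissonType K)
    (I : A -> bool) := {
  bracket_stable_subproof : forall a : A, {in I, forall x, [{ a, x }] \in I}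
}.

#[short(type="poissonIdeal")]
HB.structure Definition PoissonIdeal (K : fieldType) (A : genPoissonType K) :=
  {I of Idealr A I & isBracketStable K A I}.

Section Quotient.
Variables (K : fieldType) (A : genPoissonType K) (I : poissonIdeal A).
Local Open Scope quotient_scope.
Local Notation Q := {ideal_quot I}.

Lemma ideal_quotP (x y : A) :
  reflect (\pi_Q x = \pi_Q y) (x - y \in (I : {pred A})).
Proof. by rewrite Quotient.idealrBE; apply: eqP. Qed.

Lemma repr_ideal_quot (x : A) : repr (\pi_Q x) - x \in (I : {pred A}).
Proof. by apply/ideal_quotP; rewrite reprK. Qed.

Lemma ideal_bracketr a x :
  x \in (I : {pred A}) -> [{ a, x }] \in (I : {pred A}).
Proof. exact: bracket_stable_subproof. Qed.

Lemma ideal_bracketl a x :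
  x \in (I : {pred A}) -> [{ x, a }] \in (I : {pred A}).
Proof. by move=> Ix; rewrite bracketC rpredN ideal_bracketr. Qed.

Definition quot_scale (k : K) (x : Q) : Q := \pi_Q (k *: repr x).

Lemma pi_scale k (x : A) : \pi_Q (k *: x) = quot_scale k (\pi_Q x).
Proof.
apply/esym/ideal_quotP; rewrite -scalerBr -mulr_algl.
by apply: idealMr; apply: repr_ideal_quot.
Qed.

Fact quot_scaleA k l x : quot_scale k (quot_scale l x) = quot_scale (k * l) x.
Proof. by elim/quotW: x => x; rewrite -(pi_scale l) -!pi_scale scalerA. Qed.

Fact quot_scale1 : left_id 1 quot_scale.
Proof. by elim/quotW => x; rewrite -pi_scale scale1r. Qed.

Fact quot_scaleDr : right_distributive quot_scale +%R.
Proof.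
move=> k; elim/quotW => x; elim/quotW => y.
by rewrite -rmorphD -!pi_scale scalerDr rmorphD.
Qed.

Fact quot_scaleDl x : {morph quot_scale^~ x : k l / k + l}.
Proof. by elim/quotW: x => x k l; rewrite -!pi_scale scalerDl rmorphD. Qed.

HB.instance Definition _ := GRing.Zmodule_isLmodule.Build K Q
  quot_scaleA quot_scale1 quot_scaleDr quot_scaleDl.

Lemma pi_quotZ k (x : A) : \pi_Q (k *: x) = k *: \pi_Q x.
Proof. exact: pi_scale. Qed.

Fact quot_scaleAl k (x y : Q) : k *: (x * y) = k *: x * y.
Proof.
elim/quotW: x => x; elim/quotW: y => y.
by rewrite -rmorphM -!pi_quotZ -rmorphM scalerAl.
Qed.

HB.instance Definition _ := GRing.Lmodule_isLalgebra.Build K Q quot_scaleAl.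
HB.instance Definition _ := GRing.Lalgebra_isComAlgebra.Build K Q.

Definition quot_bracket (x y : Q) : Q := \pi_Q [{ repr x, repr y }].

Lemma pi_quot_bracket (x y : A) :
  \pi_Q [{ x, y }] = quot_bracket (\pi_Q x) (\pi_Q y).
Proof.
apply/esym/ideal_quotP; set x' := repr _; set y' := repr _.
have -> : [{ x', y' }] - [{ x, y }] = [{ x' - x, y' }] + [{ x, y' - y }].
  by rewrite bracketBl linearB /= addrA subrK.
apply: rpredD; first by apply: ideal_bracketl; apply: repr_ideal_quot.
by apply: ideal_bracketr; apply: repr_ideal_quot.
Qed.

Fact quot_bracket_linear x : linear (quot_bracket x).
Proof.
elim/quotW: x => x k; elim/quotW => y; elim/quotW => z.
rewrite -pi_quotZ -rmorphD.
by rewrite -!pi_quot_bracket linearP rmorphD /= pi_quotZ.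
Qed.

Fact quot_bracketC x y : quot_bracket x y = - quot_bracket y x.
Proof.
elim/quotW: x => x; elim/quotW: y => y.
by rewrite -!pi_quot_bracket bracketC rmorphN.
Qed.

Fact quot_bracketMr x y z :
  quot_bracket x (y * z) = quot_bracket x y * z + y * quot_bracket x z.
Proof.
elim/quotW: x => x; elim/quotW: y => y; elim/quotW: z => z.
by rewrite -rmorphM -!pi_quot_bracket -!rmorphM -rmorphD bracketMr.
Qed.

HB.instance Definition _ := isGenericPoisson.Build K Q
  quot_bracket_linear quot_bracketC quot_bracketMr.

Lemma pi_bracket (x y : A) : \pi_Q [{ x, y }] = [{ \pi_Q x, \pi_Q y }].
Proof. exact: pi_quot_bracket. Qed.

End Quotient.

(* A skew-symmetric algebra of finite dimension [n], written in coordinates: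
   the chosen basis is the canonical basis of ['rV[K]_n]. *)
Record skew_alg (K : fieldType) (n : nat) := SkewAlg {
  skprod :> 'rV[K]_n -> 'rV[K]_n -> 'rV[K]_n;
  skprod_linear : forall u, linear (skprod u);
  skprodC : forall u v, skprod u v = - skprod v u
}.

Definition ebase (K : fieldType) (n : nat) (i : 'I_n) : 'rV[K]_n :=
  delta_mx 0 i.

Definition penv (K : fieldType) (n : nat) (L : skew_alg K n) : Type :=
  {mpoly K[n]}.

HB.instance Definition _ (K : fieldType) (n : nat) (L : skew_alg K n) :=
  GRing.ComAlgebra.on (penv L).

Section PoissonEnveloping.
Variables (K : fieldType) (n : nat) (L : skew_alg K n).
Implicit Types (p q r : {mpoly K[n]}).

Definition lform (u : 'rV[K]_n) : {mpoly K[n]} := \sum_i u 0 i *: 'X_i.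

Fact lform_is_linear : linear lform.
Proof.
move=> k u v; rewrite scaler_sumr -big_split; apply: eq_bigr => i _ /=.
by rewrite !mxE scalerDl scalerA.
Qed.

HB.instance Definition _ :=
  GRing.isLinear.Build K 'rV[K]_n {mpoly K[n]} *:%R lform lform_is_linear.

(* The biderivation of K[X_0, ..., X_(n-1)] determined by
   {X_i, X_j} = [e_i, e_j], a linear form; see [penv_bracketXX] and
   [penv_bracket_unique]. *)
Definition penv_bracket p q : {mpoly K[n]} :=
  \sum_i \sum_j mderiv i p * mderiv j q * lform (L (ebase K i) (ebase K j)).

Fact penv_bracket_linear p : linear (penv_bracket p).
Proof.
move=> k q r; rewrite /penv_bracket scaler_sumr -big_split.
apply: eq_bigr => i _ /=; rewrite scaler_sumr -big_split.
apply: eq_bigr => j _ /=; rewrite mderivD mderivZ.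
by rewrite mulrDr mulrDl -scalerAr -scalerAl.
Qed.

Fact penv_bracketC p q : penv_bracket p q = - penv_bracket q p.
Proof.
rewrite /penv_bracket exchange_big -sumrN; apply: eq_bigr => j _ /=.
rewrite -sumrN; apply: eq_bigr => i _.
by rewrite skprodC linearN mulrN [mderiv j q * _]mulrC.
Qed.

Fact penv_bracketMr p q r :
  penv_bracket p (q * r) = penv_bracket p q * r + q * penv_bracket p r.
Proof.
rewrite /penv_bracket mulr_suml mulr_sumr -big_split; apply: eq_bigr => i _ /=.
rewrite mulr_suml mulr_sumr -big_split; apply: eq_bigr => j _ /=.
by rewrite mderivM; ring.
Qed.

HB.instance Definition _ := isGenericPoisson.Build K (penv L)
  penv_bracket_linear penv_bracketC penv_bracketMr.

Lemma penvE (p q : penv L) : [{ p, q }] = penv_bracket p q.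
Proof. by []. Qed.

Lemma mderivX1 (i j : 'I_n) : mderiv i 'X_j = (i == j)%:R :> {mpoly K[n]}.
Proof.
rewrite mderivX mnm1E eq_sym; case: eqP => [->|_]; last by rewrite scale0r.
by rewrite scale1r (_ : (U_(j) - U_(j))%MM = 0%MM) ?mpolyX0 //; apply/mnmP => k; rewrite !mnmE subnn.
Qed.

Lemma penv_bracketXX (i j : 'I_n) :
  [{ 'X_i : penv L, 'X_j : penv L }] = lform (L (ebase K i) (ebase K j)).
Proof.
rewrite penvE /penv_bracket (bigD1 i) //= [X in _ + X]big1 ?addr0; last first.
  move=> k nki; rewrite big1 // => l _.
  by rewrite mderivX1 (negbTE nki) !mul0r.
rewrite (bigD1 j) //= [X in _ + X]big1 ?addr0; last first.
  by move=> k nkj; rewrite [mderiv k _]mderivX1 (negbTE nkj) mulr0 mul0r.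
by rewrite !mderivX1 !eqxx !mul1r.
Qed.

End PoissonEnveloping.

(* [penv_bracket] is the only bracket extending the product of [L]. *)
Lemma penv_bracket_unique (K : fieldType) (n : nat) (L : skew_alg K n)
    (br : {mpoly K[n]} -> {mpoly K[n]} -> {mpoly K[n]}) :
    (forall p, linear (br p)) ->
    (forall p q, br p q = - br q p) ->
    (forall p q r, br p (q * r) = br p q * r + q * br p r) ->
    (forall i j, br 'X_i 'X_j = lform (L (ebase K i) (ebase K j))) ->
  forall p q, br p q = penv_bracket L p q.
Proof.
have ext (D D' : {mpoly K[n]} -> {mpoly K[n]}) :
    linear D -> linear D' ->
    (forall q r, D (q * r) = D q * r + q * D r) ->
    (forall q r, D' (q * r) = D' q * r + q * D' r) ->
    (forall i, D 'X_i = D' 'X_i) -> D =1 D'.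
  move=> lD lD' mD mD' eX.
  have d1 (E : {mpoly K[n]} -> {mpoly K[n]}) :
      (forall q r, E (q * r) = E q * r + q * E r) -> E 1 = 0.
    move=> mE; apply: (@addrI _ (E 1)).
    by rewrite addr0 -[in RHS](mulr1 1) mE mulr1 mul1r.
  have d0 (E : {mpoly K[n]} -> {mpoly K[n]}) : linear E -> E 0 = 0.
    by move=> lE; have := lE (-1) 0 0; rewrite scaler0 addr0 scaleN1r addNr.
  have eM (m : 'X_{1..n}) : D 'X_[m] = D' 'X_[m].
    rewrite mpolyXE_id; elim/big_rec: _ => [|i p _ IH]; first by rewrite !d1.
    rewrite mD mD' IH; congr (_ * _ + _).
    by elim: (m i) => [|k IHk]; rewrite ?expr0 ?d1 // exprS mD mD' IHk eX.
  elim/mpolyind => [|k m p _ _ IH]; first by rewrite !d0.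
  by rewrite lD lD' eM IH.
move=> lbr cbr mbr xbr p q.
have eXq (i : 'I_n) : br 'X_i =1 penv_bracket L 'X_i.
  apply: ext => //; [exact: penv_bracket_linear | exact: penv_bracketMr |].
  by move=> j; rewrite xbr -penv_bracketXX.
apply: (ext (br p)) => //.
- exact: penv_bracket_linear.
- exact: penv_bracketMr.
by move=> i; rewrite cbr penv_bracketC eXq.
Qed.

Section Malcev.
Variables (K : fieldType) (a b g : K).

(* [trel i j k c] stands for [f_i, f_j] = c f_k, with indices in {1, ..., 7}. *)
Definition trel (i j k : nat) (c : K) : nat * nat * nat * K := (i, j, k, c).

(* Each unordered pair of distinct indices occurs exactly once. *)
Definition malcev_table : seq (nat * nat * nat * K) :=
  [:: trel 1 2 4 1;       trel 2 4 1 b;       trel 4 1 2 a;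
      trel 2 3 5 1;       trel 3 5 2 g;       trel 5 2 3 b;
      trel 3 4 6 1;       trel 4 6 3 (a * b); trel 6 3 4 g;
      trel 4 5 7 b;       trel 5 7 4 g;       trel 7 4 5 a;
      trel 5 6 1 (b * g); trel 6 1 5 a;       trel 1 5 6 1;
      trel 6 7 2 (a * g); trel 7 2 6 1;       trel 2 6 7 b;
      trel 7 1 3 a;       trel 1 3 7 1;       trel 3 7 1 g].

(* Coordinate on f_(l+1) of the tabulated value of [f_(i+1), f_(j+1)], and 0
   when the ordered pair is not in the table: the ordinal i stands for the
   index i + 1. *)
Definition malcev_entry (i j l : 'I_7) : K :=
  \sum_(t <- malcev_table | t.1 == (i.+1, j.+1, l.+1)) t.2.

Definition malcev_sc (i j : 'I_7) : 'rV[K]_7 :=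
  \row_l (malcev_entry i j l - malcev_entry j i l).

Definition malcev_prod (u v : 'rV[K]_7) : 'rV[K]_7 :=
  \sum_i \sum_j (u 0 i * v 0 j) *: malcev_sc i j.

Fact malcev_prod_linear u : linear (malcev_prod u).
Proof.
move=> k v w; rewrite scaler_sumr -big_split; apply: eq_bigr => i _ /=.
rewrite scaler_sumr -big_split; apply: eq_bigr => j _ /=.
by rewrite !mxE scalerA -scalerDl; congr (_ *: _); ring.
Qed.

Fact malcev_prodC u v : malcev_prod u v = - malcev_prod v u.
Proof.
rewrite /malcev_prod exchange_big -sumrN; apply: eq_bigr => j _ /=.
rewrite -sumrN; apply: eq_bigr => i _; rewrite -scalerN mulrC.
by congr (_ *: _); apply/rowP => l; rewrite !mxE opprB.
Qed.

Definition malcev : skew_alg K 7 := SkewAlg malcev_prod_linear malcev_prodC.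

Lemma malcevE i j : malcev (ebase K i) (ebase K j) = malcev_sc i j.
Proof.
rewrite /= /malcev_prod (bigD1 i) //= [X in _ + X]big1 ?addr0; last first.
  move=> k nki; rewrite big1 // => l _.
  by rewrite !mxE (negbTE nki) andbF mul0r scale0r.
rewrite (bigD1 j) //= [X in _ + X]big1 ?addr0; last first.
  by move=> k nkj; rewrite !mxE (negbTE nkj) andbF mulr0 scale0r.
by rewrite !mxE !eqxx mulr1 scale1r.
Qed.

Lemma malcev_tableP (i j k : nat) (c : K) : (i, j, k, c) \in malcev_table ->
  malcev (ebase K (inord i.-1)) (ebase K (inord j.-1)) =
  c *: ebase K (inord k.-1).
Proof.
rewrite malcevE /malcev_table /trel !inE => h; apply/rowP => l.
rewrite !mxE /malcev_entry /malcev_table /trel eqxx /=.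
do ?[case/orP: h => [h|h]]; case/eqP: h => -> -> -> ->; rewrite !inordK //;
case: l => [[|[|[|[|[|[|[|//]]]]]]] ?];
by rewrite unlock -[_ == inord _]val_eqE /= inordK //=; ring.
Qed.

(* The i-th coefficient, counted from 0, is that of f_(i+1)^2. *)
Definition casimir_coef : seq K :=
  [:: b * g; a * g; a * b; g; a; 1; b].

Definition casimir : penv malcev :=
  \sum_(i < 7) casimir_coef`_i *: ('X_i ^+ 2 : {mpoly K[7]}).

Lemma casimir_sc_skew (i j l : 'I_7) :
  casimir_coef`_i * malcev_sc i j 0 l = - (casimir_coef`_l * malcev_sc l j 0 i).
Proof.
rewrite !mxE /malcev_entry /malcev_table /trel.
case: i => [[|[|[|[|[|[|[|//]]]]]]] ?];
case: j => [[|[|[|[|[|[|[|//]]]]]]] ?];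
case: l => [[|[|[|[|[|[|[|//]]]]]]] ?];
by rewrite unlock /= ?subrr ?mulr0 ?oppr0 //; ring.
Qed.

Lemma mderiv_casimir i :
  mderiv i casimir = casimir_coef`_i *: ('X_i + 'X_i).
Proof.
rewrite /casimir raddf_sum (bigD1 i) //= [X in _ + X]big1 ?addr0.
  by rewrite mderivZ expr2 mderivM mderivX1 eqxx mul1r mulr1.
move=> j nij; rewrite mderivZ expr2 mderivM mderivX1.
by rewrite eq_sym (negbTE nij) mul0r mulr0 addr0 scaler0.
Qed.

Lemma casimir_central : in_center casimir.
Proof.
move=> q; rewrite penvE /penv_bracket exchange_big big1 // => j _.
move: (mderiv j q : {mpoly K[7]}) => {q} dq.
pose T (i l : 'I_7) := (casimir_coef`_i * malcev_sc i j 0 l) *: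
  ('X_i * 'X_l : {mpoly K[7]}).
pose W := \sum_i \sum_l T i l.
have WN : W = - W.
  rewrite {1}/W exchange_big -sumrN; apply: eq_bigr => l _ /=.
  rewrite -sumrN; apply: eq_bigr => i _.
  by rewrite /T (casimir_sc_skew i) scaleNr ['X_i * _]mulrC.
transitivity (dq * (W + W)); last by rewrite {1}WN addNr mulr0.
rewrite /W -big_split mulr_sumr; apply: eq_bigr => i _ /=.
rewrite (malcevE i j : malcev_prod _ _ = _) mderiv_casimir /lform -big_split !mulr_sumr.
apply: eq_bigr => l _ /=; rewrite /T -!mul_mpolyC mpolyCM; ring.
Qed.

End Malcev.

Section CasimirQuotient.
Variables (K : fieldType) (a b g lam : K).
Local Notation P := (penv (malcev a b g)).

(* [idealr] wants a boolean predicate, hence the classical [asbool]. *)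
Definition casimir_pred : P -> bool :=
  fun p => `[< exists q : P, p = q * (casimir a b g - lam%:A) >].

Lemma casimir_idealP p :
  reflect (exists q : P, p = q * (casimir a b g - lam%:A))
          (p \in (casimir_pred : {pred P})).
Proof. exact: asboolP. Qed.

Lemma casimir_sub_nunit : (casimir a b g - lam%:A : {mpoly K[7]})
  \isn't a @GRing.unit {mpoly K[7]}.
Proof.
pose m : 'X_{1..7} := (U_(inord 5) *+ 2)%MM.
apply/negP => /andP[/eqP cE _]; have /(congr1 (mcoeff m)) := cE.
have m0 : (m == 0%MM) = false.
  by apply/eqP => /mnmP/(_ (inord 5)); rewrite !mnmE eqxx.
rewrite mcoeffC m0 mulr0 mcoeffB mcoeffZ mcoeff1 m0 mulr0 subr0.
rewrite raddf_sum (bigD1 (inord 5)) //= big1 => [|i ni]; last first.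
  rewrite mcoeffZ mcoeffXn; case: eqP => [/mnmP/(_ i)|_]; last by rewrite mulr0.
  by rewrite !mnmE eqxx eq_sym (negbTE ni).
rewrite mcoeffZ mcoeffXn eqxx inordK // addr0 mul1r => /eqP.
by rewrite oner_eq0.
Qed.

Fact casimir_ideal_closed : idealr_closed casimir_pred.
Proof.
split.
- by apply/casimir_idealP; exists 0; rewrite mul0r.
- apply/casimir_idealP => -[q q1]; case/negP: casimir_sub_nunit.
  by apply/unitrP; exists q; split; rewrite // mulrC.
move=> x u v /casimir_idealP[q ->] /casimir_idealP[r ->].
by apply/casimir_idealP; exists (x * q + r); rewrite mulrDl mulrA.
Qed.

HB.instance Definition _ := isIdealr.Build P casimir_pred casimir_ideal_closed.

Fact casimir_ideal_stable (x : P) :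
  {in (casimir_pred : {pred P}), forall p, [{ x, p }] \in (casimir_pred : {pred P})}.
Proof.
move=> p /casimir_idealP[q ->]; apply/casimir_idealP.
exists [{ x, q }]; rewrite bracketMr linearB /= bracketxA.
by rewrite (bracketC x (casimir a b g)) casimir_central !oppr0 addr0 mulr0 addr0.
Qed.

HB.instance Definition _ :=
  isBracketStable.Build K P casimir_pred casimir_ideal_stable.

Definition casimir_ideal : poissonIdeal P := casimir_pred.

Definition casimir_quot : genPoissonType K := {ideal_quot casimir_ideal}.

End CasimirQuotient.

(* Main.v *)
Require Import Defs.
From mathcomp Require Import all_boot all_order all_algebra.
From mathcomp Require Import generic_quotient ring_quotient boolp mpoly ring.
Import GRing.Theory.
Local Open Scope ring_scope.

Set Implicit Arguments.
Unset Strict Implicit.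

(** S is the coordinate ring of the affine quadric c_M = lambda, which is smooth
    because lambda <> 0.  A smooth connected variety is differentially simple
    and has only constants killed by all vector fields.  So the theorem comes
    down to two facts: the Hamiltonian derivations {f_i, -} span all the
    vector fields tangent to the quadric, and the quadric has these two
    properties.

    The first fact is special to cross products.  The product of M is, up to
    rescaling the basis, the cross product of imaginary octonions, and the
    derivations {f_i, -} are the rows of its matrix at the point x.  The
    identity x * (x * u) = <x, u> x - <x, x> u ([cross_table_sq]) shows that
    combinations of them give the fields c_i f_i E - c_M d_i, with E the Euler
    field, and hence lambda times each infinitesimal rotation
    c_i f_i d_j - c_j f_j d_i modulo c_M - lambda ([ideal_bracket_rotation]).

    The second fact is proved for any diagonal quadric in at least two
    variables, using rotations only.  Fix a variable X and write an element of
    the quotient as u + v X with u, v free of X; let w be the polynomial free of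
    X that equals a X^2 on the quadric.  If all rotations kill u + v X, then u
    and w v^2 are constants, so v = 0 ([rotation_invariant_const]).  If u + v X is a
    nonzero element of a stable ideal, its norm a u^2 - w v^2 is in the ideal.
    It is not zero since w, being squarefree, is not a square up to a constant
    ([quad_nonsquare]).  Rotations act on polynomials free of X as derivatives
    multiplied by X, so differentiating the norm down to a constant puts a power
    of X in the ideal.  Rotating X^(l+1) puts the products of X^l with the terms
    of the quadratic form in the ideal, hence X^l itself, and the exponent goes
    down until 1 is reached ([rotation_ideal]). *)

(** * Partial derivatives and division by a quadratic polynomial *)
Section Derivations.
Variables (K : fieldType) (n : nat).
Implicit Types (p q u v s : {mpoly K[n]}) (i j : 'I_n).

Lemma msize_mderiv i p m : (msize p <= m.+1)%N -> (msize p^`M(i) <= m)%N.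
Proof.
move=> pm; rewrite msizeE; apply/bigmax_leqP_seq => m' + _.
rewrite mcoeff_msupp mcoeff_mderiv => h.
have : (m' + U_(i))%MM \in msupp p.
  by rewrite mcoeff_msupp; apply: contra h => /eqP ->; rewrite mul0rn.
move/msize_mdeg_lt => h2; rewrite -ltnS; apply: leq_trans pm.
by move: h2; rewrite mdegD mdeg1 addn1.
Qed.

Lemma iter_mderiv_eq0 i p m : (msize p <= m)%N -> iter m (mderiv i) p = 0.
Proof.
elim: m p => [|m IH] p; first by rewrite leqn0 msize_poly_eq0 => /eqP.
by move=> pm; rewrite iterSr IH // msize_mderiv.
Qed.

Lemma mderivXid i : ('X_i : {mpoly K[n]})^`M(i) = 1.
Proof. by rewrite mderivX1 eqxx. Qed.

Lemma mderivX_neq i j : j != i -> ('X_i : {mpoly K[n]})^`M(j) = 0.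
Proof. by move=> ji; rewrite mderivX1 (negbTE ji). Qed.

Lemma mderivX2 i : ('X_i ^+ 2 : {mpoly K[n]})^`M(i) = 'X_i *+ 2.
Proof. by rewrite expr2 mderivM mderivXid mul1r mulr1 mulr2n. Qed.

Lemma mderiv_exp i p k : (p ^+ k.+1)^`M(i) = p^`M(i) * p ^+ k *+ k.+1.
Proof.
elim: k => [|k IH]; first by rewrite expr1 expr0 mulr1.
by rewrite exprS mderivM IH [in RHS]mulrS mulrnAr mulrCA -exprS.
Qed.

(** Leibniz formula for a factor of degree two in 'X_i, so that only three
    terms survive.  It lets a degree in 'X_i be read off by counting
    derivatives. *)
Lemma iter_mderiv_quadM i (k : K) s q m : s^`M(i) = 0 ->
  iter m.+2 (mderiv i) (q * (k%:MP * 'X_i ^+ 2 + s)) =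
    iter m.+2 (mderiv i) q * (k%:MP * 'X_i ^+ 2 + s)
    + iter m.+1 (mderiv i) q * (k%:MP * 'X_i) *+ (m.+2 * 2)
    + iter m (mderiv i) q * k%:MP *+ (m.+2 * m.+1).
Proof.
move=> s0.
have dw : (k%:MP * 'X_i ^+ 2 + s)^`M(i) = k%:MP * 'X_i *+ 2.
  by rewrite mderivD s0 addr0 mderiv_mulC mderivX2 mulrnAr.
elim: m => [|m IH].
  by rewrite /= !(dw, mderivXid, mderivC, mderivMn, mderivM, mderivD); ring.
rewrite iterS IH !(dw, mderivXid, mderivC, mderivMn, mderivM, mderivD) -!iterS.
set A := iter m.+3 _ _; set B := iter m.+2 _ _; set C := iter m.+1 _ _.
move: A B C (k%:MP) 'X_i s {s0 dw IH} => A B C k' X s'.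
by ring.
Qed.

(** Division with remainder in 'X_i.  Independence of 'X_i is expressed by
    the vanishing of the derivative, which amounts to it in characteristic
    zero and keeps all the polynomials in one ring. *)
Lemma quad_div_ex i (k : K) s p : k != 0 -> s^`M(i) = 0 ->
  exists q u v, [/\ p = q * (k%:MP * 'X_i ^+ 2 + s) + (u + v * 'X_i),
    u^`M(i) = 0 & v^`M(i) = 0].
Proof.
move=> k0 s0; set w := _ + s.
have kK : (k^-1)%:MP * k%:MP = 1 :> {mpoly K[n]}.
  by rewrite -mpolyCM mulVf // mpolyC1.
pose D p := exists q u v, [/\ p = q * w + (u + v * 'X_i),
    u^`M(i) = 0 & v^`M(i) = 0].
have DX j p' : D p' -> D ('X_j * p').
  case=> q [u [v [-> u0 v0]]]; have [->|ji] := eqVneq j i.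
    (* 'X_i * (v * 'X_i) creates a term in 'X_i ^+ 2, which is traded for
       (w - s) / k. *)
    exists ('X_i * q + v * (k^-1)%:MP), (- v * (k^-1)%:MP * s), u; split=> //.
      have -> : 'X_i * (q * w + (u + v * 'X_i)) =
        'X_i * q * w + v * ((k^-1)%:MP * k%:MP) * 'X_i ^+ 2 + u * 'X_i.
        by rewrite kK; ring.
      by rewrite /w; ring.
    by rewrite !mderivM s0 mderivC mderivN v0; ring.
  have Xj0 : ('X_j : {mpoly K[n]})^`M(i) = 0.
    by rewrite mderivX_neq // eq_sym.
  exists ('X_j * q), ('X_j * u), ('X_j * v); split; first by ring.
    by rewrite mderivM Xj0 u0; ring.
  by rewrite mderivM Xj0 v0; ring.
elim/mpolyind: p => [|c m p _ _ [q [u [v [-> u0 v0]]]]].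
  by exists 0, 0, 0; rewrite mderiv0; split=> //; ring.
have [q' [u' [v' [-> u0' v0']]]] : D 'X_[m].
  rewrite mpolyXE_id; elim/big_rec: _ => [|j p' _ IH].
    exists 0, 1, 0; rewrite mderiv0 -mpolyC1 mderivC; split=> //.
    by rewrite !mpolyC1; ring.
  by elim: (m j) => [|e IHe]; rewrite ?mul1r // exprS -mulrA; apply: DX.
exists (c%:MP * q' + q), (c%:MP * u' + u), (c%:MP * v' + v).
rewrite !mderivD !mderiv_mulC u0 v0 u0' v0' -mul_mpolyC !mulr0 addr0.
by split=> //; ring.
Qed.

Hypothesis charK0 : [pchar K] =i pred0.

Lemma mpolyMn_eq0 p m : p *+ m.+1 = 0 -> p = 0.
Proof.
have m0 : m.+1%:R != 0 :> K by have /pcharf0P -> := charK0.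
move=> /eqP; rewrite -mulr_natl -mpolyC_nat mulf_eq0 mpolyC_eq0 (negbTE m0).
by move=> /eqP.
Qed.

Lemma mderiv_eq0P p : (forall i, p^`M(i) = 0) -> p = (p@_0)%:MP.
Proof.
move=> dp; apply/mpolyP => m; rewrite mcoeffC eq_sym.
have [->|/eqP m0] := eqVneq m 0%MM; first by rewrite mulr1.
rewrite mulr0.
have [i mi] : exists i, (0 < m i)%N.
  apply/existsP; apply: contra_notT m0 => /existsPn h.
  by apply/mnmP => i; apply/eqP; rewrite mnm0E -leqn0 leqNgt h.
have /eqP := congr1 (mcoeff (m - U_(i))) (dp i).
rewrite mcoeff0 mcoeff_mderiv submK ?lep1mP -?lt0n // -mulr_natl mulf_eq0.
by have /pcharf0P -> := charK0 => /eqP.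
Qed.

(** If q <> 0 and m is the last order for which the m-th derivative of q in
    'X_i is nonzero, then m + 2 derivatives applied to the left-hand side leave
    a nonzero multiple of it by [iter_mderiv_quadM], while two already kill
    the right-hand side. *)
Lemma quad_div_uniq i (k : K) s q u v : k != 0 -> s^`M(i) = 0 ->
    u^`M(i) = 0 -> v^`M(i) = 0 ->
    q * (k%:MP * 'X_i ^+ 2 + s) = u + v * 'X_i ->
  [/\ q = 0, u = 0 & v = 0].
Proof.
move=> k0 s0 u0 v0 e.
suff q0 : q = 0.
  move: e; rewrite q0 mul0r => /esym e.
  have v00 : v = 0.
    have := congr1 (mderiv i) e.
    by rewrite mderivD mderivM u0 v0 mderivXid mderiv0 mul0r !add0r mulr1.
  by split=> //; move: e; rewrite v00 mul0r addr0.
have top m : iter m.+1 (mderiv i) q = 0 -> iter m (mderiv i) q = 0.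
  move=> qm.
  have : iter m.+2 (mderiv i) (q * (k%:MP * 'X_i ^+ 2 + s)) = 0.
    rewrite e 2!iterSr mderivD mderivM u0 v0 mderivXid mul0r !add0r mulr1 v0.
    by apply: iter_mderiv_eq0; rewrite msize0.
  rewrite iter_mderiv_quadM // iterS qm mderiv0 !mul0r mul0rn !add0r.
  rewrite mulSn addSn => /mpolyMn_eq0/eqP.
  by rewrite mulf_eq0 mpolyC_eq0 (negbTE k0) orbF => /eqP.
have: iter (msize q) (mderiv i) q = 0 by exact: iter_mderiv_eq0.
by elim: (msize q) => [|m IH] // /top.
Qed.
End Derivations.

(** * Rotation-stable ideals containing an affine quadric *)
Section Quadric.
Variables (K : fieldType) (n : nat).
Hypothesis charK0 : [pchar K] =i pred0.
Implicit Types (p q u v s : {mpoly K[n]}) (i j : 'I_n) (k c : K).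

(** A quadratic polynomial w = k * 'X_i ^+ 2 + s with s <> 0 is not a square in
    the field of fractions, even up to a constant.  Such a w is squarefree: if
    it divides p ^+ 2, it divides p, as one sees by squaring the remainder
    u + v * 'X_i.  Then w divides p, hence q, and dividing both by w gives a
    smaller solution of the same equation. *)
Lemma quad_nonsquare i k s c p q : k != 0 -> s^`M(i) = 0 -> s != 0 -> c != 0 ->
  c%:MP * p ^+ 2 = (k%:MP * 'X_i ^+ 2 + s) * q ^+ 2 -> p = 0 /\ q = 0.
Proof.
move=> k0 s0 sn0; set w := _ + s.
have uniq := quad_div_uniq charK0 k0 s0; rewrite -/w in uniq.
have w0 : w != 0.
  apply/eqP => w0; have := oner_neq0 {mpoly K[n]}.
  have [|||-> _ _] := uniq 1 0 0; rewrite ?mderiv0 ?eqxx // w0; ring.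
have size_w : (1 < msize w)%N.
  rewrite ltnNge; apply/negP => /msize1_polyC wE.
  have := oner_neq0 {mpoly K[n]}.
  have [|||-> _ _] := uniq 1 w 0; rewrite ?mderiv0 ?eqxx //; last by ring.
  by rewrite wE mderivC.
(* Squarefreeness: with x = t w + u + v 'X_i, the remainder of k d x ^+ 2
   modulo w is d (k u ^+ 2 - v ^+ 2 s) + 2 k d u v 'X_i, hence zero. *)
have dvd d x y : d != 0 -> d%:MP * x ^+ 2 = w * y ^+ 2 -> exists t, x = t * w.
  move=> d0 e; have [t [u [v [xE u0 v0]]]] := quad_div_ex x k0 s0.
  rewrite -/w in xE.
  have [|||_ /eqP uE /eqP] := uniq
      (k%:MP * y ^+ 2 - (2 * k%:MP * d%:MP * t * (u + v * 'X_i)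
      + k%:MP * d%:MP * t ^+ 2 * w) - d%:MP * v ^+ 2)
      (d%:MP * (k%:MP * u ^+ 2 - v ^+ 2 * s)) ((2 * k * d)%:MP * (u * v)).
  - by rewrite mderiv_mulC mderivB mderiv_mulC !expr2 !mderivM u0 v0 s0; ring.
  - by rewrite mderiv_mulC mderivM u0 v0; ring.
  - have kyw : k%:MP * y ^+ 2 * w = k%:MP * (d%:MP * x ^+ 2) by rewrite e; ring.
    by rewrite !mulrBl kyw xE !mpolyCM mpolyC_nat /w; ring.
  have k2 : (2 * k * d)%:MP != 0 :> {mpoly K[n]}.
    rewrite mpolyC_eq0 !mulf_neq0 //.
    by have /pcharf0P -> := charK0.
  rewrite mulf_eq0 (negbTE k2) mulf_eq0 /=.
  move: uE; rewrite mulf_eq0 mpolyC_eq0 (negbTE d0) subr_eq0 /= => /eqP uE uv0.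
  exists t; rewrite xE; suff [-> ->] : u = 0 /\ v = 0 by ring.
  case/orP: uv0 => /eqP z0; move: uE; rewrite z0 expr0n ?mulr0 ?mul0r => /eqP.
    by rewrite eq_sym mulf_eq0 (negbTE sn0) orbF sqrf_eq0 => /eqP ->.
  by rewrite mulf_eq0 mpolyC_eq0 (negbTE k0) sqrf_eq0 => /eqP ->.
have [m] := ubnP (msize p); elim: m c p q => // m IH c p q pm c0 e.
have [t pE] := dvd _ _ _ c0 e.
have e1 : (1 : K)%:MP * q ^+ 2 = w * (c%:MP * t ^+ 2).
  by apply: (mulfI w0); rewrite mpolyC1 mul1r -e pE; ring.
have [p0|pn0] := eqVneq p 0.
  split=> //; move: e; rewrite p0 expr0n mulr0 => /esym/eqP.
  by rewrite mulf_eq0 (negbTE w0) sqrf_eq0 => /eqP.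
have tn0 : t != 0 by apply: contra pn0 => /eqP t0; rewrite pE t0 mul0r.
have cK : (c^-1)%:MP * c%:MP = 1 :> {mpoly K[n]}.
  by rewrite -mpolyCM mulVf // mpolyC1.
have [r qE] : exists r, q = r * w.
  apply: (dvd c^-1 _ t); first by rewrite invr_eq0.
  by rewrite -[q ^+ 2]mul1r -mpolyC1 e1 mulrCA (mulrA _ _ (t ^+ 2)) cK mul1r.
have [] := IH c t r _ c0.
- move: pm; rewrite pE msizeM // => pm; rewrite -ltnS; apply: leq_trans pm.
  by rewrite ltnS; case: (msize w) size_w => [|[|l]] // _; rewrite !addnS /= leq_addr.
- by apply: (mulfI w0); rewrite -e1 mpolyC1 mul1r qE; ring.
by move=> t0; rewrite t0 eqxx in tn0.
Qed.

Variables (a : 'I_n -> K) (lam : K).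

Definition quadric : {mpoly K[n]} := \sum_i (a i)%:MP * 'X_i ^+ 2.

(** Half the derivation d_i(quadric) d_j - d_j(quadric) d_i: an
    infinitesimal rotation, tangent to the level sets of [quadric]. *)
Definition rotation i j p : {mpoly K[n]} :=
  (a i)%:MP * 'X_i * p^`M(j) - (a j)%:MP * 'X_j * p^`M(i).

Local Notation C := (quadric - lam%:MP).

Definition mideal (J : {mpoly K[n]} -> Prop) : Prop :=
  [/\ J 0, forall p q, J p -> J q -> J (p + q) & forall p q, J q -> J (p * q)].

Lemma mderiv_quadric_sub i : C^`M(i) = (a i)%:MP * 'X_i *+ 2.
Proof.
rewrite mderivB mderivC subr0 /quadric raddf_sum (bigD1 i) //= big1 => [|j ji].
  by rewrite mderiv_mulC mderivX2 mulrnAr addr0.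
by rewrite mderiv_mulC expr2 mderivM mderivX_neq 1?eq_sym //; ring.
Qed.

Lemma rotationD i j p q : rotation i j (p + q) = rotation i j p + rotation i j q.
Proof. by rewrite /rotation !mderivD; ring. Qed.

Lemma rotationM i j p q :
  rotation i j (p * q) = rotation i j p * q + p * rotation i j q.
Proof. by rewrite /rotation !mderivM; ring. Qed.

Lemma rotation_quadric_sub i j : rotation i j C = 0.
Proof. by rewrite /rotation !mderiv_quadric_sub; ring. Qed.

(** On the quadric, [coquad i] is the value of a_i * 'X_i ^+ 2.  It is free of
    'X_i. *)
Definition coquad i : {mpoly K[n]} := (a i)%:MP * 'X_i ^+ 2 - C.

Lemma quadric_coquad i : C = (a i)%:MP * 'X_i ^+ 2 + - coquad i.
Proof. by rewrite /coquad; ring. Qed.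

Lemma mderiv_coquad i j :
  (coquad i)^`M(j) = if j == i then 0 else - ((a j)%:MP * 'X_j *+ 2).
Proof.
rewrite mderivB mderiv_quadric_sub mderiv_mulC.
have [->|ji] := eqVneq j i; first by rewrite mderivX2; ring.
by rewrite expr2 mderivM mderivX_neq //; ring.
Qed.

Hypotheses (a0 : forall i, a i != 0) (lam0 : lam != 0).

(** [coquad i] is again a quadratic polynomial in any other variable, with a
    remainder that takes the value lam at the origin.  This is where lam <> 0
    enters in the nonsquareness of [coquad i]. *)
Lemma coquad_quad i j : j != i -> exists s,
  [/\ coquad i = (- a j)%:MP * 'X_j ^+ 2 + s, s^`M(j) = 0 & s != 0].
Proof.
move=> ji; exists (coquad i + (a j)%:MP * 'X_j ^+ 2); split.
- by rewrite mpolyCN; ring.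
- by rewrite mderivD mderiv_coquad (negbTE ji) mderiv_mulC mderivX2; ring.
have eval0 l : meval (fun=> 0) ((a l)%:MP * 'X_l ^+ 2 : {mpoly K[n]}) = 0.
  by rewrite mevalM rmorphXn /= mevalXU expr0n mulr0.
apply: contra lam0 => /eqP /(congr1 (meval (fun=> 0))) /eqP.
rewrite /coquad /quadric mevalD mevalB mevalB !eval0 raddf_sum meval0 mevalC.
rewrite big1 => [|l _]; last exact: eval0.
by rewrite addr0 !add0r opprK.
Qed.

Variables (i0 i1 : 'I_n).
Hypothesis i10 : i1 != i0.

Lemma quadric_div_ex p : exists q u v,
  [/\ p = q * C + (u + v * 'X_i0), u^`M(i0) = 0 & v^`M(i0) = 0].
Proof.
rewrite (quadric_coquad i0); apply: quad_div_ex => //.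
by rewrite mderivN mderiv_coquad eqxx oppr0.
Qed.

Lemma quadric_div_uniq q u v : u^`M(i0) = 0 -> v^`M(i0) = 0 ->
  q * C = u + v * 'X_i0 -> [/\ q = 0, u = 0 & v = 0].
Proof.
rewrite (quadric_coquad i0); apply: quad_div_uniq => //.
by rewrite mderivN mderiv_coquad eqxx oppr0.
Qed.

(** Write z = u + v * 'X_i0 modulo the quadric.  Reducing the rotations of z in
    the same way gives d_j u = 0 and w * d_j v = a_j * 'X_j * v, where
    w = [coquad i0] has derivative - 2 a_j * 'X_j.  So u is a constant and so is
    w * v ^+ 2, which forces v = 0 because w has positive degree in 'X_i1. *)
Lemma rotation_invariant_const z :
    (forall j, exists q, rotation i0 j z = q * C) ->
  exists k q, z = k%:MP + q * C.
Proof.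
move=> rz; have [q [u [v [zE u0 v0]]]] := quadric_div_ex z.
have duv j : u^`M(j) = 0 /\ j != i0 /\ coquad i0 * v^`M(j) = (a j)%:MP * 'X_j * v
             \/ j = i0.
  have [|ji] := eqVneq j i0; [by right | left].
  have [r rE] := rz j.
  have [|||_ e1 /eqP] := @quadric_div_uniq (r - rotation i0 j q - v^`M(j))
     (coquad i0 * v^`M(j) - (a j)%:MP * 'X_j * v) ((a i0)%:MP * u^`M(j)).
  - rewrite mderivB !mderivM mderiv_coquad eqxx mderiv_comm v0 mderiv0 mderivC.
    by rewrite mderivX_neq 1?eq_sym //; ring.
  - by rewrite mderiv_mulC mderiv_comm u0 mderiv0 mulr0.
  - rewrite !mulrBl -rE zE rotationD rotationM rotation_quadric_sub /coquad.
    rewrite [rotation _ _ (u + _)]/rotation !mderivD !mderivM u0 v0.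
    rewrite mderivXid mderivX_neq //.
    by rewrite /rotation; ring.
  rewrite mulf_eq0 mpolyC_eq0 (negbTE (a0 _)) => /eqP du; split=> //; split=> //.
  by apply/eqP; rewrite -subr_eq0 e1.
have uE : u = (u@_0)%:MP.
  by apply: mderiv_eq0P => // j; have [[]|->] := duv j.
have [s [wE s0 sn0]] := coquad_quad i10.
have wv : coquad i0 * v ^+ 2 = ((coquad i0 * v ^+ 2)@_0)%:MP.
  apply: mderiv_eq0P => // j; rewrite expr2 !mderivM mderiv_coquad.
  have [[_ [ji e]]|->] := duv j; last by rewrite eqxx v0; ring.
  rewrite (negbTE ji).
  transitivity ((coquad i0 * v^`M(j) - (a j)%:MP * 'X_j * v) * v *+ 2); first by ring.
  by rewrite e; ring.
have [|||||/eqP] := @quad_div_uniq _ _ charK0 i1 (- a i1) s (v ^+ 2)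
   ((coquad i0 * v ^+ 2)@_0)%:MP 0 => //.
- by rewrite oppr_eq0.
- by rewrite mderivC.
- by rewrite mderiv0.
- by rewrite -wE mulrC {1}wv; ring.
rewrite sqrf_eq0 => /eqP ve _ _.
by exists u@_0, q; rewrite -uE zE ve; ring.
Qed.

Section StableIdeal.
Variable J : {mpoly K[n]} -> Prop.
Hypotheses (idJ : mideal J) (JC : J C).
Hypothesis (rotJ : forall j p, J p -> J (rotation i0 j p)).

Let J0 : J 0. Proof. by case: idJ. Qed.
Let JD p q : J p -> J q -> J (p + q). Proof. by case: idJ => _ h _; apply: h. Qed.
Let JM p q : J q -> J (p * q). Proof. by case: idJ => _ _; apply. Qed.
Let JN p : J p -> J (- p). Proof. by rewrite -mulN1r; apply: JM. Qed.

Lemma ideal_cancel k p : k != 0 -> J (k%:MP * p) -> J p.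
Proof.
move=> k0 /(@JM (k^-1)%:MP).
by rewrite mulrA -mpolyCM mulVf // mpolyC1 mul1r.
Qed.

(** The norm of u + v * 'X_i0 over the ring of polynomials without 'X_i0, scaled
    by a_i0, is a multiple of p modulo the quadric; it is nonzero because
    [coquad i0] is not a square up to a constant. *)
Lemma ideal_meets_mderiv_ker p : J p -> ~ (exists q, p = q * C) ->
  exists r, [/\ J r, r^`M(i0) = 0 & r != 0].
Proof.
move=> Jp pC; have [q [u [v [pE u0 v0]]]] := quadric_div_ex p.
exists ((a i0)%:MP * u ^+ 2 - coquad i0 * v ^+ 2); split.
- have -> : (a i0)%:MP * u ^+ 2 - coquad i0 * v ^+ 2 =
     ((a i0)%:MP * (u - v * 'X_i0)) * p +
     (v ^+ 2 - (a i0)%:MP * (u - v * 'X_i0) * q) * C.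
    by rewrite {1}pE /coquad; ring.
  by apply: JD; apply: JM.
- rewrite mderivB mderiv_mulC !expr2 !mderivM mderiv_coquad eqxx u0 v0; ring.
rewrite subr_eq0; apply/eqP => e; apply: pC; exists q.
have [s [wE s0 sn0]] := coquad_quad i10.
have a10 : - a i1 != 0 by rewrite oppr_eq0.
rewrite wE in e; have [uz vz] := quad_nonsquare a10 s0 sn0 (a0 i0) e.
by rewrite pE uz vz; ring.
Qed.

(** Up to the unit a_i0 and to a term in J, the rotation in the plane (i0, j)
    acts on polynomials without 'X_i0 as 'X_i0 times the j-th derivative.  The
    powers of 'X_i0 absorb the effect of the rotation on 'X_i0 itself. *)
Lemma ideal_mderiv m j s : s^`M(i0) = 0 -> J ('X_i0 ^+ m * s) ->
  J ('X_i0 ^+ m.+2 * s^`M(j)).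
Proof.
move=> s0 Js; have [->|ji] := eqVneq j i0; first by rewrite s0 mulr0.
apply: (ideal_cancel (a0 i0)).
have d0 : ('X_i0 ^+ m : {mpoly K[n]})^`M(j) = 0.
  by case: m {Js} => [|m]; rewrite ?expr0 -?mpolyC1 ?mderivC //
    mderiv_exp mderivX_neq // mul0r mul0rn.
have d1 : 'X_i0 * ('X_i0 ^+ m : {mpoly K[n]})^`M(i0) = 'X_i0 ^+ m *+ m.
  case: m {Js d0} => [|m]; first by rewrite expr0 -mpolyC1 mderivC mulr0 mulr0n.
  by rewrite mderiv_exp mderivXid mul1r mulrnAr -exprS.
have -> : (a i0)%:MP * ('X_i0 ^+ m.+2 * s^`M(j)) =
   'X_i0 * rotation i0 j ('X_i0 ^+ m * s)
   + ((a j)%:MP * 'X_j *+ m) * ('X_i0 ^+ m * s).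
  rewrite /rotation !mderivM d0 s0 mul0r add0r mulr0 addr0.
  transitivity ((a i0)%:MP * ('X_i0 ^+ m.+2 * s^`M(j)) -
      (a j)%:MP * 'X_j * ('X_i0 * ('X_i0 ^+ m)^`M(i0)) * s
      + (a j)%:MP * 'X_j *+ m * ('X_i0 ^+ m * s)).
    by rewrite d1; ring.
  by rewrite !exprS; ring.
by apply: JD; apply: JM => //; apply: rotJ.
Qed.

(** Differentiating s until a nonzero constant remains. *)
Lemma ideal_has_pow m s : s^`M(i0) = 0 -> s != 0 -> J ('X_i0 ^+ m * s) ->
  exists l, J ('X_i0 ^+ l).
Proof.
have [b] := ubnP (msize s); elim: b m s => // b IH m s sb s0 sn0 Js.
have [/existsP[j dj]|/existsPn h] := boolP [exists j, s^`M(j) != 0].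
  apply: (IH m.+2 s^`M(j)) => //; last exact: ideal_mderiv.
    case: b sb {IH} => [|b] sb; last by rewrite ltnS msize_mderiv.
    by move: sn0; rewrite -msize_poly_eq0; case: (msize s) sb.
  by rewrite mderiv_comm s0 mderiv0.
have sE : s = (s@_0)%:MP.
  by apply: mderiv_eq0P => // j; apply/eqP; have := h j; rewrite negbK.
exists m; apply: (@ideal_cancel s@_0); last by rewrite -sE mulrC.
by rewrite -(mpolyC_eq0 n) -sE.
Qed.

(** Rotating 'X_i0 ^+ l.+1 shows that every a_j * 'X_j ^+ 2 * 'X_i0 ^+ l is in J,
    so [quadric] * 'X_i0 ^+ l is in J.  As [quadric] is lam modulo J, the
    exponent l.+1 goes down to l. *)
Lemma ideal_unit l : J ('X_i0 ^+ l) -> J 1.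
Proof.
elim: l => [|l IH] Jl; first by rewrite expr0 in Jl.
apply: IH; apply: (ideal_cancel lam0).
have JaX j : J ((a j)%:MP * 'X_j ^+ 2 * 'X_i0 ^+ l).
  have [->|ji] := eqVneq j i0.
    by rewrite expr2 -!mulrA -exprS; do 2 apply: JM.
  have lK : l.+1%:R != 0 :> K by have /pcharf0P -> := charK0.
  apply: (ideal_cancel lK).
  have -> : (l.+1%:R)%:MP * ((a j)%:MP * 'X_j ^+ 2 * 'X_i0 ^+ l) =
     - 'X_j * rotation i0 j ('X_i0 ^+ l.+1).
    rewrite /rotation !mderiv_exp mderivX_neq // mderivXid mpolyC_nat.
    rewrite mul0r mul0rn mulr0 mul1r mulr_natl.
    by ring.
  by apply/JM/rotJ.
have -> : lam%:MP * 'X_i0 ^+ l = quadric * 'X_i0 ^+ l + - ('X_i0 ^+ l * C).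
  by ring.
apply: JD; last by apply/JN/JM.
rewrite /quadric mulr_suml.
by elim/big_rec: _ => // j p _ Jp; apply: JD.
Qed.

(** Smooth quadrics are differentially simple: a rotation-stable ideal that
    strictly contains the ideal of the quadric is the whole ring. *)
Lemma rotation_ideal p : J p -> ~ (exists q, p = q * C) -> J 1.
Proof.
move=> Jp pC; have [r [Jr r0 rn0]] := ideal_meets_mderiv_ker Jp pC.
have [|l] := ideal_has_pow (m := 0) r0 rn0; first by rewrite expr0 mul1r.
exact: ideal_unit.
Qed.
End StableIdeal.

End Quadric.

(** * The seven-dimensional cross product *)
Section CrossProduct.
Variables (R : comNzRingType) (a b g : R) (x : nat -> R).

(** Row i, column j: the product of f_(i+1) and f_(j+1) in M(a, b, g), with x_k
    in place of f_(k+1).  Rescaling the basis vectors by square roots of a, b,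
    g turns it into the cross product of the imaginary octonions. *)
Definition cross_table (i j : nat) : R := nth 0 (nth [::] [::
  [:: 0; x 3; x 6; - (a * x 1); x 5; - (a * x 4); - (a * x 2)];
  [:: - x 3; 0; x 4; b * x 0; - (b * x 2); b * x 6; - x 5];
  [:: - x 6; - x 4; 0; x 5; g * x 1; - (g * x 3); g * x 0];
  [:: a * x 1; - (b * x 0); - x 5; 0; b * x 6; a * b * x 2; - (a * x 4)];
  [:: - x 5; b * x 2; - (g * x 1); - (b * x 6); 0; b * g * x 0; g * x 3];
  [:: a * x 4; - (b * x 6); g * x 3; - (a * b * x 2); - (b * g * x 0); 0; a * g * x 1];
  [:: a * x 2; x 5; - (g * x 0); a * x 4; - (g * x 3); - (a * g * x 1); 0]] i) j.

Definition cross_coef : seq R :=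
  [:: b * g; a * g; a * b; g; a; 1; b].

(** The cross product identity x * (x * u) = <x, u> x - <x, x> u, in coordinates
    and with the scalar product rescaled to the Casimir form. *)
Lemma cross_table_sq (i l : 'I_7) :
  cross_coef`_i * \sum_(j < 7) cross_coef`_j * cross_table i j * cross_table j l =
  a * b * g * (cross_coef`_i * x i * x l
    - (i == l)%:R * \sum_(j < 7) cross_coef`_j * x j ^+ 2).
Proof.
rewrite !big_ord_recl !big_ord0 /= /bump /=.
case: i => [[|[|[|[|[|[|[|//]]]]]]] ?];
case: l => [[|[|[|[|[|[|[|//]]]]]]] ?];
by rewrite -val_eqE /= ?mulr1n ?mulr0n /cross_table /=; ring.
Qed.
End CrossProduct.

(** * From brackets on the Malcev algebra to rotations *)
Section MalcevBracket.
Variables (K : fieldType) (a b g lam : K).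
Local Notation P := (penv (malcev a b g)).
Local Notation coef := (fun i : 'I_7 => (casimir_coef a b g)`_i).
Local Notation C := (quadric coef - lam%:MP).

Lemma lform_malcev (i j : 'I_7) :
  lform (malcev_sc a b g i j) =
  cross_table a%:MP b%:MP g%:MP (fun k => 'X_(inord k)) i j.
Proof.
pose x k : {mpoly K[7]} := 'X_(inord k).
rewrite -[RHS]/(cross_table _ _ _ x i j).
pose sc (i j l : nat) : K :=
  \sum_(t <- malcev_table a b g | t.1 == (i.+1, j.+1, l.+1)) t.2.
have -> : lform (malcev_sc a b g i j) =
    \sum_(l < 7) (sc i j l - sc j i l)%:MP * x l.
  by apply: eq_bigr => l _; rewrite mxE mul_mpolyC /x inord_val.
rewrite !big_ord_recl !big_ord0 /= /bump /= /sc /malcev_table /trel.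
case: i => [[|[|[|[|[|[|[|//]]]]]]] ?];
case: j => [[|[|[|[|[|[|[|//]]]]]]] ?];
rewrite unlock /= /cross_table /=; clearbody x.
all: by ring.
Qed.

Lemma casimirE : casimir a b g = quadric coef.
Proof. by apply: eq_bigr => i _; rewrite mul_mpolyC. Qed.

Lemma penv_bracketX i (p : {mpoly K[7]}) : [{ ('X_i : {mpoly K[7]}) : P, p : P }] =
  \sum_j lform (malcev_sc a b g i j) * p^`M(j).
Proof.
rewrite penvE /penv_bracket (bigD1 i) //= [X in _ + X]big1 ?addr0 => [|k ki].
  apply: eq_bigr => j _.
  by rewrite (malcevE a b g i j : malcev_prod _ _ _ _ _ = _) mderivXid mul1r mulrC.
by rewrite big1 // => j _; rewrite mderivX_neq // !mul0r.
Qed.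

(** Substituting the cross product identity: combinations of the Hamiltonian
    derivations of the generators produce the fields
    c_i x_i E - c_M d_i, where E is the Euler field and c_M the Casimir. *)
Lemma penv_bracketX_sq i (p : {mpoly K[7]}) :
  (coef i)%:MP * \sum_j (coef j)%:MP * lform (malcev_sc a b g i j) *
      [{ ('X_j : {mpoly K[7]}) : P, p : P }] =
  (a * b * g)%:MP * ((coef i)%:MP * 'X_i * \sum_l 'X_l * p^`M(l)
     - quadric coef * p^`M(i)).
Proof.
pose x k : {mpoly K[7]} := 'X_(inord k).
have cE (j : 'I_7) : (coef j)%:MP = (cross_coef a%:MP b%:MP g%:MP)`_j :> {mpoly K[7]}.
  by case: j => [[|[|[|[|[|[|[|//]]]]]]] ?]; rewrite /= ?mpolyCM ?mpolyC1.
have xE (j : 'I_7) : 'X_j = x j by rewrite /x inord_val.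
have cas : quadric coef = \sum_(j < 7) (cross_coef a%:MP b%:MP g%:MP)`_j * x j ^+ 2.
  by apply: eq_bigr => j _; rewrite cE xE.
transitivity (\sum_l ((coef i)%:MP * \sum_(j < 7) (coef j)%:MP *
    lform (malcev_sc a b g i j) * lform (malcev_sc a b g j l)) * p^`M(l)).
  under eq_bigr => j _ do rewrite penv_bracketX mulr_sumr.
  rewrite exchange_big mulr_sumr; apply: eq_bigr => l _ /=.
  by rewrite -mulrA mulr_suml; congr (_ * _); apply: eq_bigr => j _; rewrite mulrA.
transitivity (\sum_l (a * b * g)%:MP * ((coef i)%:MP * 'X_i * ('X_l * p^`M(l))
    - (i == l)%:R * (quadric coef * p^`M(l)))).
  apply: eq_bigr => l _; rewrite cas cE !xE.
  under eq_bigr => j _ do rewrite !lform_malcev cE.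
  by rewrite cross_table_sq !mpolyCM /x; ring.
rewrite -mulr_sumr sumrB -mulr_sumr; congr (_ * (_ - _)).
rewrite (bigD1 i) //= big1 => [|l li]; first by rewrite eqxx mul1r addr0.
by rewrite eq_sym (negbTE li) mul0r.
Qed.

Hypotheses (a0 : a != 0) (b0 : b != 0) (g0 : g != 0) (lam0 : lam != 0).

Lemma coef_neq0 i : coef i != 0.
Proof.
by case: i => [[|[|[|[|[|[|[|//]]]]]]] ?] /=; rewrite ?mulf_neq0 ?oner_neq0.
Qed.

(** Eliminating the Euler field between the fields of [penv_bracketX_sq] for i
    and j leaves the Casimir times the rotation, and the Casimir is the
    invertible constant lam modulo J.  With J the ideal of the quadric this
    applies to representatives of central elements of the quotient, and with J
    stable under brackets to all elements of J. *)
Lemma ideal_bracket_rotation (J : {mpoly K[7]} -> Prop) (p : {mpoly K[7]}) :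
  mideal J -> J C ->
  (forall k, J [{ ('X_k : {mpoly K[7]}) : P, p : P }]) ->
  forall i j, J (rotation coef i j p).
Proof.
move=> idJ JC Jp i j; have [J0 JD JM] := idJ.
pose V i := (coef i)%:MP * 'X_i * (\sum_l 'X_l * p^`M(l)) - quadric coef * p^`M(i).
have JV k : J (V k).
  apply: (ideal_cancel idJ (k := a * b * g)); first by rewrite !mulf_neq0.
  rewrite -penv_bracketX_sq; apply: (JM).
  by apply: (big_ind J) => // l _; apply: JM.
apply: (ideal_cancel idJ lam0).
have -> : lam%:MP * rotation coef i j p =
  (coef j)%:MP * 'X_j * V i + (- ((coef i)%:MP * 'X_i)) * V j
    + (- rotation coef i j p) * C by rewrite /V /rotation; ring.
by apply: (JD); [apply: (JD)|]; apply: JM.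
Qed.

Local Open Scope quotient_scope.
Local Notation S := (casimir_quot a b g lam).
Local Notation piS := (\pi_({ideal_quot (casimir_ideal a b g lam)}) : P -> S).

Lemma casimir_quot_eq0 (p : P) : piS p = 0 <-> exists q : {mpoly K[7]}, p = q * C.
Proof.
have -> : (exists q : {mpoly K[7]}, p = q * C) <->
    exists q : P, p = q * (casimir a b g - lam%:A).
  by rewrite casimirE alg_mpolyC.
rewrite -[0 in X in X <-> _](rmorph0 piS).
split=> [/ideal_quotP|[q e]]; first by rewrite subr0 => /casimir_idealP.
by apply/ideal_quotP; rewrite subr0; apply/casimir_idealP; exists q.
Qed.

End MalcevBracket.

(** * Centrality and simplicity *)
Theorem theorem2 (K : fieldType) (charK0 : [pchar K] =i pred0)
    (alpha beta gamma lambda : K)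
    (alpha_neq0 : alpha != 0) (beta_neq0 : beta != 0) (gamma_neq0 : gamma != 0)
    (lambda_neq0 : lambda != 0) :
  poisson_central (casimir_quot alpha beta gamma lambda) /\
  poisson_simple (casimir_quot alpha beta gamma lambda).
Proof.
set S := casimir_quot alpha beta gamma lambda.
pose P := penv (malcev alpha beta gamma).
pose coef (i : 'I_7) := (casimir_coef alpha beta gamma)`_i.
pose C := quadric coef - lambda%:MP.
have c0 : forall i, coef i != 0 by exact: coef_neq0.
pose piS : P -> S := \pi_({ideal_quot (casimir_ideal alpha beta gamma lambda)})%qT.
have pi0P (p : P) : piS p = 0 <-> exists q, p = q * C by exact: casimir_quot_eq0.
have piZ k (p : P) : piS (k *: p) = k *: piS p by exact: pi_quotZ.
have piB (p q : P) : piS [{ p, q }] = [{ piS p, piS q }] by exact: pi_bracket.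
have piD (p q : P) : piS (p + q) = piS p + piS q by exact: rmorphD.
have piM (p q : P) : piS (p * q) = piS p * piS q by exact: rmorphM.
have pi1 : piS 1 = 1 by exact: rmorph1.
have piW (x : S) : exists p, x = piS p by exists (repr x); rewrite /piS reprK.
have i10 : (inord 1 : 'I_7) != inord 0 by rewrite -val_eqE /= !inordK.
have idC : mideal (fun p => exists q, p = q * C).
  split=> [|p q [r ->] [s ->]|p q [r ->]].
  - by exists 0; rewrite mul0r.
  - by exists (r + s); rewrite mulrDl.
  - by exists (p * r); rewrite mulrA.
have CC : exists q, C = q * C by exists 1; rewrite mul1r.
have rot := ideal_bracket_rotation alpha_neq0 beta_neq0 gamma_neq0 lambda_neq0.
split=> [x|I [I0 ID IM IB]].
  split=> [|[k ->] y]; last by rewrite bracketC bracketxA oppr0.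
  have [z ->] := piW x => cz.
  have [|k [q zE]] := rotation_invariant_const charK0 c0 lambda_neq0 i10 (z := z).
    move=> j; apply: (rot _ z idC CC) => k.
    by apply/pi0P; rewrite piB bracketC cz oppr0.
  exists k; rewrite zE -alg_mpolyC piD piZ pi1.
  have -> : piS (q * C) = 0 by apply/pi0P; exists q.
  by rewrite addr0.
pose J (p : P) := I (piS p).
have idJ : mideal J.
  split=> [|p q Jp Jq|p q Jq]; rewrite /J.
  - by have -> : piS 0 = 0 by exact: rmorph0.
  - by rewrite piD; apply: ID.
  - by rewrite piM; apply: IM.
have JC : J C by rewrite /J; have -> : piS C = 0 by apply/pi0P.
have rotJ j p : J p -> J (rotation coef (inord 0) j p).
  by move=> Jp; apply: (rot J p idJ JC) => k; rewrite /J piB; apply: IB.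
have [[p [Jp pC]]|h] := pselect (exists p, J p /\ ~ exists q, p = q * C).
  right=> x; rewrite -[x]mulr1 -pi1; apply: IM.
  exact: (rotation_ideal charK0 c0 lambda_neq0 i10 idJ JC rotJ Jp pC).
left=> x; split=> [|-> //]; have [p ->] := piW x => Ip.
by apply/pi0P; apply: contrapT => pC; apply: h; exists p.
Qed.
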